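(* Let $\lambda\in(0,\infty)$, $p_n=\lambda/n$, let $G_n$ be the Erdős–Rényi random graph $G(n,p_n)$, and let $a\in(0,1)$. Conditionally on $V_T(G_n)\ge an$, the number of edges $e(G_n)$ of $G_n$ is concentrated around $(a+\lambda/2)n$; that is, for every $\varepsilon>0$, $$\lim_{n\to\infty}\mathbb{P}\left(\left|\frac{e(G_n)}{n}-\Big(a+\frac{\lambda}{2}\Big)\right|>\varepsilon\,\Big|\,V_T(G_n)\ge an\right)=0.$$
   Context: $G(n,p)$ is the random simple graph on vertex set $[n]=\{1,\dots,n\}$ in which each possible edge is present independently with probability $p$. For a graph $G$, $V_T(G)$ is the number of vertices of $G$ that belong to at least one triangle of $G$, and $e(G)$ is the number of edges of $G$. *)

(* Defs.v *)
From HB Require Import structures.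
From mathcomp Require Import all_boot all_order all_algebra.
From mathcomp Require Import reals.

Set Implicit Arguments.
Unset Strict Implicit.
Unset Printing Implicit Defensive.

Import Order.TTheory GRing.Theory Num.Theory.

Local Open Scope ring_scope.

Definition vertex_pairs (n : nat) : {set {set 'I_n}} := [set e : {set 'I_n} | #|e| == 2%N].

(* A simple graph is given by its edge set; the vertices are 0, ..., n-1. *)
Definition graph (n : nat) : finType :=
  {E : {set {set 'I_n}} | E \subset vertex_pairs n}.

Definition edges (n : nat) (G : graph n) : {set {set 'I_n}} := val G.

Definition num_edges (n : nat) (G : graph n) : nat := #|edges G|.

(* Irreflexive, because [set x; x] has one element and so is not an edge. *)
Definition adj (n : nat) (G : graph n) (x y : 'I_n) : bool :=
  [set x; y] \in edges G.

Definition in_triangle (n : nat) (G : graph n) (x : 'I_n) : bool :=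
  [exists y, exists z, [&& adj G x y, adj G y z & adj G x z]].

Definition num_triangle_vertices (n : nat) (G : graph n) : nat :=
  #|[set x | in_triangle G x]|.

(* The law of G(n, p): the product over all vertex pairs of Bernoulli(p) laws.
   It is a probability only for 0 <= p <= 1. *)
Definition gnp_mass (R : realType) (n : nat) (p : R) (G : graph n) : R :=
  \prod_(e in vertex_pairs n) (if e \in edges G then p else 1 - p).

Definition gnp_prob (R : realType) (n : nat) (p : R) (A : pred (graph n)) : R :=
  \sum_(G : graph n | A G) gnp_mass p G.

Definition gnp_cond_prob (R : realType) (n : nat) (p : R)
    (A B : pred (graph n)) : R :=
  gnp_prob p (predI A B) / gnp_prob p B.

(* Main.v *)
Require Import Defs.
From mathcomp Require Import all_boot all_order all_algebra.
From mathcomp Require Import classical_sets reals topology normedtype sequences.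
From mathcomp Require Import exp ring lra zify.
Import boot.fintype boot.finset.

Set Implicit Arguments.
Unset Strict Implicit.
Unset Printing Implicit Defensive.

Import Order.TTheory GRing.Theory Num.Theory.
Import numFieldNormedType.Exports.

(** The cheapest way to put a n vertices into triangles is to have about a n / 3
vertex-disjoint ones.  They carry a n edges, while the other pairs stay independent
and contribute about lambda n / 2 edges; this is where a + lambda / 2 comes from.
Since a deviation of the number of edges only costs a factor exponential in n, while
the conditioning event has probability n ^ (- a n / 3) up to exponential factors, the
two probabilities have to be compared up to a factor that is subexponential in n.

Let m be the least integer not below a n, let k be m / 3 rounded up, and let X be the
expected number of k-packings in G, a k-packing being a set of k disjoint triples; X
is #|packings n k| * p ^ (3 k).  The two sides are compared with X.

Lower bound (triangle_vertices_lower).  Given that G contains a k-packing, the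
expected number of other triangles is bounded, so with probability at least 1/2 there
are at most M of them.  A graph with at most k + M triangles contains at most
C(k + M, k) packings of size k, which is polynomial in n.  Hence V_T >= a n has
probability at least X divided by a polynomial.

Upper bound (triangle_witness, sum_extensions, gnp_joint_upper).  If V_T >= a n, a
packing F of j <= k triangles, maximal in G or of size k, is completed by a minimal
set S of r further triangles until m vertices are covered.  Each of them brings at
most two new vertices, so 3 j + 2 r >= m.  By minimality each triangle of S has a
private vertex, hence brings at least two new edges whichever the order in which the
triangles of S are revealed; so the r-sets S together weigh at most C ^ r / r!.  As
a < 1, a packing can be enlarged in many ways, and passing from j to k triples costs
a factor (O(n)) ^ (k - j), where k - j is at most about 2 r / 3.  The total is
about X times the sum over r of (C n ^ (2/3)) ^ r / r!, which is subexponential; here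
n ^ (2/3) may be replaced by eta n with a small eta, which yields exp (C eta n).

Deviation (gnp_edges_deviation).  Given that the edges of F and S are present, their
number differs from a n by O(r), and an exponential moment bounds the probability of a
deviation eps n of the number of edges by exp (O(theta r) - c n).  The factor
exp (O(theta r)) is absorbed in C ^ r, and exp (- c n) beats exp (C eta n) and the
polynomial factors. *)

(** * Triples of vertices and the pairs they contain *)

Definition triples (n : nat) : {set {set 'I_n}} := [set t : {set 'I_n} | #|t| == 3%N].

Definition sides (n : nat) (t : {set 'I_n}) : {set {set 'I_n}} :=
  [set e in vertex_pairs n | e \subset t].

Definition sides_of (n : nat) (F : {set {set 'I_n}}) : {set {set 'I_n}} :=
  \bigcup_(t in F) sides t.

Definition triangles (n : nat) (G : graph n) : {set {set 'I_n}} :=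
  [set t in triples n | sides t \subset edges G].

Lemma in_sides n (t e : {set 'I_n}) :
  (e \in sides t) = (#|e| == 2%N) && (e \subset t).
Proof. by rewrite !inE. Qed.

Lemma sidesS n (t : {set 'I_n}) : sides t \subset vertex_pairs n.
Proof. by apply/subsetP=> e; rewrite !inE => /andP[]. Qed.

Lemma sides_ofS n (F : {set {set 'I_n}}) : sides_of F \subset vertex_pairs n.
Proof. by apply/bigcupsP=> t _; apply: sidesS. Qed.

Lemma card_sides n (t : {set 'I_n}) : t \in triples n -> #|sides t| = 3%N.
Proof.
rewrite inE => /eqP t3.
have -> : sides t = [set e : {set 'I_n} | e \subset t & #|e| == 2%N].
  by apply/setP=> e; rewrite in_sides inE andbC.
by rewrite cards_draws t3.
Qed.

Lemma sides_ofP n (F : {set {set 'I_n}}) e :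
  reflect (exists2 t, t \in F & e \in sides t) (e \in sides_of F).
Proof. exact: bigcupP. Qed.

Lemma sides_ofU n (F S : {set {set 'I_n}}) :
  sides_of (F :|: S) = sides_of F :|: sides_of S.
Proof. exact: bigcup_setU. Qed.

Lemma sides_of1U n (F : {set {set 'I_n}}) t :
  sides_of (t |: F) = sides t :|: sides_of F.
Proof. by rewrite sides_ofU /sides_of big_set1. Qed.

Lemma card_sides_of_le n (F : {set {set 'I_n}}) :
  F \subset triples n -> #|sides_of F| <= 3 * #|F|.
Proof.
move=> /subsetP Ft.
rewrite /sides_of mulnC -sum_nat_const.
elim/big_rec2: _ => [|t s1 s2 tF IH]; first by rewrite cards0.
by rewrite (leq_trans (leq_card_setU _ _))// (card_sides (Ft _ tF)) leq_add2l.
Qed.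

Lemma sides_of_cover n (F : {set {set 'I_n}}) e :
  e \in sides_of F -> e \subset cover F.
Proof.
case/sides_ofP=> t tF; rewrite in_sides => /andP[_ et].
exact: subset_trans et (bigcup_sup _ tF).
Qed.

(** Two of the three sides of a triple meet at each of its vertices. *)
Lemma fresh_vertex_sides n (t : {set 'I_n}) x (H : {set {set 'I_n}}) :
  t \in triples n -> x \in t ->
  (forall e, e \in sides t -> x \in e -> e \notin H) -> 2 <= #|sides t :\: H|.
Proof.
rewrite inE => /eqP t3 xt hH.
have /cards2P[y [z [yz tE]]] : #|t :\ x| == 2%N.
  by have := cardsD1 x t; rewrite xt t3 => /eqP; rewrite eqSS eq_sym.
have [yx yt] : y != x /\ y \in t by apply/andP; rewrite -in_setD1 tE !inE eqxx.
have [zx zt] : z != x /\ z \in t.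
  by apply/andP; rewrite -in_setD1 tE !inE eqxx orbT.
have new w : w != x -> w \in t -> [set x; w] \in sides t :\: H.
  move=> wx wt; rewrite inE.
  have sd : [set x; w] \in sides t.
    by rewrite in_sides cards2 [x == w]eq_sym wx subUset !sub1set xt wt.
  by rewrite sd hH// !inE eqxx.
have ne : [set x; y] != [set x; z].
  apply/negP=> /eqP /setP /(_ y); rewrite !inE eqxx orbT.
  by rewrite (negbTE yx) (negbTE yz).
have <- : #|[set [set x; y]; [set x; z]]| = 2%N by rewrite cards2 ne.
by apply/subset_leq_card/subsetP => e; rewrite in_set2 => /orP[]/eqP->; apply: new.
Qed.

Lemma new_vertex_sides n (F : {set {set 'I_n}}) t :
  t \in triples n -> ~~ (t \subset cover F) -> 2 <= #|sides t :\: sides_of F|.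
Proof.
move=> t3 /subsetPn[x xt xF]; apply: (fresh_vertex_sides t3 xt) => e _ xe.
by apply: contra xF => /sides_of_cover /subsetP; apply.
Qed.

(** Two sides of [t] share a vertex.  If both were sides of triples of [F], these triples
would meet, hence coincide, and contain all of [t].  So at most one side of [t] is old. *)
Lemma packing_new_sides n (F : {set {set 'I_n}}) t :
  F \subset triples n -> trivIset F -> t \in triples n -> t \notin F ->
  2 <= #|sides t :\: sides_of F|.
Proof.
move=> F3 Fdisj t3 tF.
have [|/forallPn[e]] := boolP [forall e, (e \in sides t) ==> (e \notin sides_of F)].
  move=> /forallP h; have : t != set0.
    by apply: contraTneq t3 => ->; rewrite inE cards0.
  case/set0Pn=> x xt; apply: (fresh_vertex_sides t3 xt) => e et _.
  by have := h e; rewrite et.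
rewrite negb_imply negbK => /andP[et /sides_ofP[u uF eu]].
have u3 : u \in triples n by apply: (subsetP F3).
have: ~~ (t \subset u).
  apply: contra tF => tu; suff -> : t = u by [].
  by apply/eqP; rewrite eqEcard tu; move: t3 u3; rewrite !inE => /eqP-> /eqP->.
case/subsetPn=> x xt xu; apply: (fresh_vertex_sides t3 xt) => f ft xf.
apply/negP=> /sides_ofP[v vF fv].
have : e :&: f != set0.
  apply/negP=> /eqP ef0.
  have : #|e :|: f| <= #|t|.
    by apply: subset_leq_card; move: et ft; rewrite !in_sides subUset => /andP[_->] /andP[_->].
  rewrite cardsU ef0 cards0 subn0.
  by move: et ft t3; rewrite !in_sides !inE => /andP[/eqP-> _] /andP[/eqP-> _] /eqP->.
case/set0Pn=> y; rewrite inE => /andP[ye yf].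
move: eu fv; rewrite !in_sides => /andP[_ /subsetP eu] /andP[_ /subsetP fv].
suff uv : u = v by rewrite uv (fv _ xf) in xu.
apply: contraNeq (_ : ~~ [disjoint u & v]) => [uv|].
  by move/trivIsetP: Fdisj; apply.
by apply/pred0Pn; exists y; rewrite /= eu// fv.
Qed.

(** Disjoint triples have no pair in common. *)
Lemma card_sides_packing n (F : {set {set 'I_n}}) :
  F \subset triples n -> trivIset F -> #|sides_of F| = 3 * #|F|.
Proof.
move=> /subsetP F3 /trivIsetP Fd.
have disj : {in F &, forall t u, u != t -> [disjoint sides t & sides u]}.
  move=> t u tF uF ut; apply/pred0Pn => -[e] /=; rewrite !in_sides.
  move=> /andP[/andP[/eqP e2 et] /andP[_ eu]].
  have : ~~ [disjoint t & u].
    apply/pred0Pn; have /set0Pn[x xe] : e != set0 by rewrite -card_gt0 e2.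
    by exists x; rewrite /= (subsetP et)// (subsetP eu).
  by rewrite Fd// eq_sym.
have ne0 : set0 \notin [set sides t | t in F].
  by apply/imsetP => -[t /F3 /card_sides + s0]; rewrite -s0 cards0.
have [/eqP tr inj] := trivIimset disj ne0.
rewrite /sides_of -cover_imset -tr big_imset //= mulnC -sum_nat_const.
by apply: eq_bigr => t /F3 /card_sides.
Qed.

Lemma card_cover_packing n (F : {set {set 'I_n}}) :
  F \subset triples n -> trivIset F -> #|cover F| = 3 * #|F|.
Proof.
move=> /subsetP F3 /eqP <-; rewrite mulnC -sum_nat_const.
by apply: eq_bigr => t /F3; rewrite inE => /eqP.
Qed.

Lemma card_sides_of1U n (F : {set {set 'I_n}}) t :
  #|sides_of (t |: F)| = #|sides_of F| + #|sides t :\: sides_of F|.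
Proof.
rewrite sides_of1U -(cardsID (sides_of F)); congr addn; apply: eq_card => e.
  by rewrite in_setI in_setU; case: (e \in sides_of F); rewrite ?orbT ?andbF.
by rewrite !in_setD in_setU; case: (e \in sides_of F); rewrite ?orbF.
Qed.

Lemma num_triangle_verticesE n (G : graph n) :
  num_triangle_vertices G = #|cover (triangles G)|.
Proof.
congr #|pred_of_set _|; apply/setP=> x; rewrite inE.
have Gp e : e \in edges G -> #|e| = 2%N.
  by move/(subsetP (valP G)); rewrite inE => /eqP.
apply/idP/bigcupP=> [|[t]].
  case/existsP=> y /existsP[z /and3P[xy yz xz]].
  move: (Gp _ xy) (Gp _ yz) (Gp _ xz); rewrite !cards2.
  case: eqP => // /eqP nxy _; case: eqP => // /eqP nyz _; case: eqP => // /eqP nxz _.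
  exists (x |: [set y; z]); last by rewrite !inE eqxx.
  have t3 : x |: [set y; z] \in triples n.
    by rewrite inE cardsU1 cards2 !inE negb_or nxy nxz nyz.
  rewrite inE t3; apply/subsetP => e; rewrite in_sides => /andP[/cards2P[u [v [uv ->]]]].
  rewrite subUset !sub1set !inE => /andP[].
  case/or3P=> /eqP ux /or3P[]/eqP vx; rewrite ux vx ?eqxx // in uv *; by rewrite setUC.
rewrite !inE => /andP[t3 /subsetP tG] xt.
have /cards2P[y [z [yz tE]]] : #|t :\ x| == 2%N.
  by have := cardsD1 x t; rewrite xt (eqP t3) => /eqP; rewrite eqSS eq_sym.
have [yx yt] : y != x /\ y \in t by apply/andP; rewrite -in_setD1 tE !inE eqxx.
have [zx zt] : z != x /\ z \in t.
  by apply/andP; rewrite -in_setD1 tE !inE eqxx orbT.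
apply/existsP; exists y; apply/existsP; exists z; apply/and3P.
by split; rewrite /adj; apply: tG; rewrite in_sides cards2 subUset !sub1set ?xt ?yt ?zt ?yz // [x == _]eq_sym ?yx ?zx.
Qed.

(** A triple with side [e] is [e] together with a third vertex. *)
Lemma card_triples_side n (e : {set 'I_n}) : (#|[set t in triples n | e \in sides t]| <= n)%N.
Proof.
have sub : [set t in triples n | e \in sides t] \subset [set x |: e | x : 'I_n].
  apply/subsetP=> t; rewrite inE in_sides inE => /andP[/eqP t3 /andP[/eqP e2 et]].
  have : ~~ (t \subset e).
    by apply/negP=> /subset_leq_card; rewrite t3 e2.
  case/subsetPn=> x xt xe; apply/imsetP; exists x => //; apply/eqP.
  by rewrite eq_sym eqEcard subUset sub1set xt et t3 cardsU1 xe e2.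
apply: leq_trans (subset_leq_card sub) _.
by rewrite (leq_trans (leq_imset_card _ _)) ?card_ord.
Qed.

Lemma bin_le_exp n m : ('C(n, m) <= n ^ m)%N.
Proof.
apply: (@leq_trans (n ^_ m)); first by rewrite -bin_ffact leq_pmulr ?fact_gt0.
elim: m => [|m IH] //=.
by rewrite expnSr ffactnSr leq_mul ?leq_subr.
Qed.

Local Open Scope ring_scope.

(** A triple with three sides outside [H] is one of at most n ^ 3.  A triple with only two
is determined by its side in [H] and its third vertex.  For p = O(1/n) and #|H| = O(n)
both terms are bounded: this is the price of one more triangle once [H] is present. *)
Lemma sum_new_sides (R : realType) n (p : R) (H T : {set {set 'I_n}}) :
  0 <= p <= 1 -> T \subset triples n ->
  (forall t, t \in T -> (2 <= #|sides t :\: H|)%N) ->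
  \sum_(t in T) p ^+ #|sides t :\: H| <= n%:R ^+ 3 * p ^+ 3 + #|H|%:R * (n%:R * p ^+ 2).
Proof.
move=> /andP[p0 p1] /subsetP T3 Tnew.
have bd t : t \in T ->
    p ^+ #|sides t :\: H| <= p ^+ 3 + \sum_(e in H | e \in sides t) p ^+ 2.
  move=> tT; have := cardsID H (sides t); rewrite (card_sides (T3 _ tT)).
  have := Tnew _ tT; case: #|_ :\: H| => [|[|[|[|m]]]]//.
  - move=> _; rewrite addn2 => -[] /eqP /cards1P[e eE].
    have : e \in sides t :&: H by rewrite eE inE.
    rewrite inE => /andP[et eH]; rewrite (bigD1 e) ?eH//=.
    by rewrite addrA addrAC lerDr addr_ge0 ?exprn_ge0// sumr_ge0 // => *; rewrite exprn_ge0.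
  - by move=> _ _; rewrite lerDl sumr_ge0 // => *; rewrite exprn_ge0.
  - by move=> _; rewrite !addnS.
apply: le_trans (ler_sum _ bd) _; rewrite big_split /=; apply: lerD.
  rewrite sumr_const -[X in X <= _]mulr_natl ler_wpM2r ?exprn_ge0 // -natrX ler_nat.
  apply: leq_trans (subset_leq_card (introT subsetP T3)) _.
  by rewrite card_draws card_ord bin_le_exp.
rewrite (exchange_big_dep (mem H)) /=; last by move=> t e _ /andP[].
rewrite [leRHS]mulr_natl -sumr_const ler_sum // => e eH.
rewrite sumr_const -[X in X <= _]mulr_natl ler_wpM2r ?exprn_ge0 // ler_nat.
apply: leq_trans (card_triples_side e); apply: subset_leq_card.
by apply/subsetP=> t; rewrite unfold_in => /and3P[/T3 tT _ et]; rewrite inE tT.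
Qed.

(** * The law of the random graph *)

Lemma gnp_mass_ge0 (R : realType) n (p : R) (G : graph n) :
  0 <= p <= 1 -> 0 <= gnp_mass p G.
Proof.
by move=> /andP[p0 p1]; apply: prodr_ge0 => e _; case: ifP; rewrite ?subr_ge0.
Qed.

Lemma ler_sum_sub (R : numDomainType) (I : finType) (P Q : pred I) (F G : I -> R) :
  (forall i, P i -> Q i /\ F i <= G i) -> (forall i, Q i -> 0 <= G i) ->
  \sum_(i | P i) F i <= \sum_(i | Q i) G i.
Proof.
move=> PQ G0; rewrite big_mkcond [leRHS]big_mkcond; apply: ler_sum => i _.
by case: ifPn => [/PQ[-> //]|_]; case: ifPn => // /G0.
Qed.

(** Expanding the product over all pairs of (weight if absent) + (weight if present) gives
the sum over all graphs; for the pairs in [H] only the second weight is kept. *)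
Lemma gnp_tilt (R : realType) n (p x : R) (H : {set {set 'I_n}}) :
  H \subset vertex_pairs n ->
  \sum_(G : graph n | H \subset edges G) gnp_mass p G * x ^+ num_edges G =
  (p * x) ^+ #|H| * (1 - p + p * x) ^+ #|vertex_pairs n :\: H|.
Proof.
move=> Hn.
pose w (E : {set {set 'I_n}}) : R :=
  \prod_(e in vertex_pairs n) (if e \in E then p * x else 1 - p).
(* Weight 0 for the presence of a set that is not a pair, weight 1 for its absence,
   so that the sum over all sets of subsets reduces to graphs. *)
pose f (e : {set 'I_n}) : R := if e \in vertex_pairs n then p * x else 0.
pose g (e : {set 'I_n}) : R :=
  if e \in vertex_pairs n then (if e \in H then 0 else 1 - p) else 1.
transitivity (\sum_(E in [pred E : {set {set 'I_n}} | E \subset vertex_pairs n]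
   | H \subset E) w E).
  rewrite big_sub_cond; apply: eq_bigr => G _.
  have -> : x ^+ num_edges G =
      \prod_(e in vertex_pairs n) (if e \in edges G then x else 1).
    rewrite -big_mkcondr -prodr_const; apply: eq_bigl => e.
    by rewrite andb_idl // => /(subsetP (valP G)).
  rewrite /gnp_mass /w -big_split /=; apply: eq_bigr => e _.
  by case: ifP; rewrite ?mulr1.
transitivity (\prod_e (f e + g e)); last first.
  rewrite -!prodr_const [in RHS]big_mkcond [X in _ * X]big_mkcond -big_split /=.
  apply: eq_bigr => e _; rewrite /f /g in_setD.
  have := subsetP Hn e; case: (e \in H) => [->//|_].
    by rewrite addr0 mulr1.
  by case: (e \in _); rewrite ?mul1r ?add0r // addrC.
rewrite bigA_distr big_mkcond; apply: eq_bigr => E _; rewrite /= !inE.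
case: ifPn => [/andP[En HE]|].
  rewrite /w big_mkcond; apply: eq_bigr => e _; rewrite /f /g.
  have := subsetP En e; have := subsetP HE e.
  by case: (e \in H); case: (e \in E); case: (e \in vertex_pairs n) => // h1 h2;
    first [by have := h1 isT | by have := h2 isT].
rewrite negb_and => /orP[/subsetPn[e eE en]|/subsetPn[e eH eE]].
  by rewrite (bigD1 e) //= eE /f (negbTE en) mul0r.
by rewrite (bigD1 e) //= (negbTE eE) /g (subsetP Hn _ eH) eH mul0r.
Qed.

Lemma gnp_contains (R : realType) n (p : R) (H : {set {set 'I_n}}) :
  H \subset vertex_pairs n ->
  \sum_(G : graph n | H \subset edges G) gnp_mass p G = p ^+ #|H|.
Proof.
move=> Hn; have := gnp_tilt p 1 Hn; rewrite mulr1 subrK expr1n mulr1 => <-.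
by apply: eq_bigr => G _; rewrite expr1n mulr1.
Qed.

(** Double counting of the pairs of a set and one of its elements.  It yields the factor
1 / r! when sets of r triples are built one triple at a time. *)
Lemma sum_remove_elt (V : nmodType) (T : finType) (P : pred {set T}) (w : {set T} -> V) :
  \sum_(S | P S) w S *+ #|S| =
  \sum_(S : {set T}) \sum_(t | (t \notin S) && P (t |: S)) w (t |: S).
Proof.
under eq_bigr do rewrite -sumr_const.
rewrite (exchange_big_dep xpredT) // [RHS](exchange_big_dep xpredT) //=.
apply: eq_bigr => t _.
rewrite (reindex_onto (fun S => t |: S) (fun S => S :\ t)) /=; last first.
  by move=> S /andP[_ tS]; rewrite setD1K.
apply: eq_bigl => S; rewrite setU11 andbT andbC; congr andb.
apply/eqP/idP => [<-|tS]; first by rewrite setD11.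
by rewrite setU1K.
Qed.

(** * Packings of triples and their extensions *)

Definition packings n j : {set {set {set 'I_n}}} :=
  [set F : {set {set 'I_n}} | [&& F \subset triples n, trivIset F & #|F| == j]].

(** Privacy does not depend on an order on [S]: this makes every enumeration of [S] reveal
a new vertex, hence two new sides, at each step. *)
Definition private_cover n (F S : {set {set 'I_n}}) : bool :=
  [forall t in S, ~~ (t \subset cover (F :|: (S :\ t)))].

Definition extensions n (F : {set {set 'I_n}}) r : {set {set {set 'I_n}}} :=
  [set S : {set {set 'I_n}} | [&& S \subset triples n, private_cover F S & #|S| == r]].

Lemma private_coverP n (F S : {set {set 'I_n}}) :
  reflect (forall t, t \in S -> ~~ (t \subset cover (F :|: (S :\ t)))) (private_cover F S).
Proof. exact: 'forall_implyP. Qed.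

Lemma coverS n (F S : {set {set 'I_n}}) : F \subset S -> cover F \subset cover S.
Proof. by move=> /subsetP FS; apply/bigcupsP=> t /FS; apply: bigcup_sup. Qed.

Lemma private_coverU1 n (F S : {set {set 'I_n}}) t :
  t \notin S -> private_cover F (t |: S) ->
  private_cover F S /\ ~~ (t \subset cover (F :|: S)).
Proof.
move=> tS /private_coverP pc; split; last first.
  by have := pc t (setU11 _ _); rewrite setU1K.
apply/private_coverP => u uS; have := pc u (setU1r _ uS).
apply: contra => /subset_trans; apply; apply: coverS; apply: setUS.
by apply: setSD; apply: subsetUr.
Qed.

(** Private vertices of distinct triples are distinct. *)
Lemma card_private_cover n (F S : {set {set 'I_n}}) : private_cover F S -> (#|S| <= n)%N.
Proof.
move=> /private_coverP pc.
pose f (t : {set 'I_n}) := [pick x in t :\: cover (F :|: (S :\ t))].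
have fP t : t \in S -> exists2 x, f t = Some x & x \in t :\: cover (F :|: (S :\ t)).
  move=> tS; rewrite /f; case: pickP => [x xt|none]; first by exists x.
  have /subsetPn[x xt xn] := pc _ tS.
  by have := none x; rewrite inE xt xn.
have finj : {in S &, injective f}.
  move=> t u tS uS eqf; apply/eqP/negPn/negP => tu.
  have [x ft] := fP _ tS; have [y fu] := fP _ uS.
  have <- : x = y by move: eqf; rewrite ft fu => -[].
  rewrite !inE => /andP[_ xu] /andP[/negP xn _]; apply: xn.
  apply/bigcupP; exists u => //; by rewrite !inE uS [u == _]eq_sym tu orbT.
rewrite -(card_in_imset finj) -[leqRHS]card_ord -[leqRHS](card_imset _ (@Some_inj _)).
apply: subset_leq_card; apply/subsetP => _ /imsetP[t tS ->].
by have [x -> _] := fP _ tS; apply: imset_f.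
Qed.

Lemma packingsP n j (F : {set {set 'I_n}}) : F \in packings n j ->
  [/\ F \subset triples n, trivIset F, #|F| = j, (3 * j <= n)%N & #|sides_of F| = (3 * j)%N].
Proof.
rewrite inE => /and3P[F3 Fd /eqP <-]; rewrite card_sides_packing //; split=> //.
by rewrite -card_cover_packing // -[leqRHS]card_ord max_card.
Qed.

(** Removing any triple [t] from an extension of size r + 1 leaves one of size r, and [t]
has a vertex not covered by it.  So by [sum_new_sides] the weight is multiplied by at
most a constant at each step, and each extension of size r + 1 is reached r + 1 times. *)
Lemma sum_extensions (R : realType) n (p : R) j (F : {set {set 'I_n}}) r :
  0 <= p <= 1 -> F \in packings n j ->
  \sum_(S in extensions F r) p ^+ #|sides_of (F :|: S)| <=
  p ^+ (3 * j) * ((n%:R * p) ^+ 3 + 4 * (n%:R * p) ^+ 2) ^+ r / r`!%:R.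
Proof.
move=> p01 /packingsP[F3 Fd Fj jn Fs]; have /andP[p0 p1] := p01.
set C : R := _ + _ * _.
have C0 : 0 <= C by rewrite addr_ge0 ?mulr_ge0 ?exprn_ge0 ?mulr_ge0.
have rfact k : (0 : R) < k`!%:R by rewrite ltr0n fact_gt0.
elim: r => [|r IH].
  rewrite fact0 divr1 expr0 mulr1 (_ : extensions F 0 = [set set0]).
    by rewrite big_set1 setU0 Fs.
  apply/setP=> S; rewrite !inE cards_eq0 andbA andb_idl // => /eqP ->.
  by rewrite sub0set; apply/private_coverP=> t; rewrite inE.
rewrite ler_pdivlMr // factS natrM mulrA [_ * r.+1%:R]mulr_natr -sumrMnl.
rewrite -ler_pdivlMr // exprSr mulrA mulrAC.
have {}IH := ler_wpM2r C0 IH; apply: (le_trans _ IH) => {IH}.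
rewrite /= mulr_suml.
rewrite (eq_bigr (fun S => p ^+ #|sides_of (F :|: S)| *+ #|S|)); last first.
  by move=> S; rewrite inE => /and3P[_ _ /eqP ->].
(* [S] now is the extension of size r, and [t] the triple added to it. *)
rewrite sum_remove_elt [leRHS]big_mkcond; apply: ler_sum => S _.
case: ifPn => SE; last first.
  rewrite big_pred0 // => t; apply/negbTE; apply: contra SE => /andP[tS].
  rewrite !inE => /and3P[]; rewrite subUset cardsU1 tS add1n eqSS => /andP[_ ->].
  by move=> /(private_coverU1 tS)[-> _] ->.
move: SE; rewrite inE => /and3P[S3 Spc /eqP Sr].
pose H := sides_of (F :|: S).
pose T := [set t in triples n | ~~ (t \subset cover (F :|: S))].
apply: (@le_trans _ _ (\sum_(t in T) p ^+ #|H| * p ^+ #|sides t :\: H|)).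
  apply: ler_sum_sub => t; last by rewrite mulr_ge0 ?exprn_ge0.
  move=> /andP[tS]; rewrite inE => /and3P[]; rewrite subUset sub1set => /andP[t3 _].
  move=> /(private_coverU1 tS)[_ tn] _; rewrite inE t3 tn; split => //.
  by rewrite -exprD setUCA card_sides_of1U.
rewrite -mulr_sumr ler_wpM2l ?exprn_ge0 //.
apply: le_trans (sum_new_sides p01 _ _) _.
- by apply/subsetP=> t; rewrite inE => /andP[].
- by move=> t; rewrite inE => /andP[t3 tn]; apply: new_vertex_sides.
have -> : C = n%:R ^+ 3 * p ^+ 3 + (4 * n)%:R * (n%:R * p ^+ 2).
  by rewrite /C natrM; ring.
rewrite lerD2l ler_wpM2r ?mulr_ge0 ?exprn_ge0 // ler_nat. apply: (@leq_trans (3 * #|F :|: S|)).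
  by apply: card_sides_of_le; rewrite subUset F3 S3.
have := card_private_cover Spc; have [+ _] := leq_card_setU F S.
by rewrite Fj; lia.
Qed.

Lemma sides_of_triangles n (G : graph n) (F : {set {set 'I_n}}) :
  F \subset triangles G -> sides_of F \subset edges G.
Proof.
by move=> /subsetP FG; apply/bigcupsP => t /FG; rewrite inE => /andP[].
Qed.

(** [F] is a maximal packing among those with at most k triangles.  If it has k of them, it
suffices.  Otherwise all triangles meet the vertices of [F], so each brings at most two
new vertices, and [S] is an inclusion-minimal set completing the cover. *)
Lemma triangle_witness n (G : graph n) m k :
  (m <= #|cover (triangles G)|)%N -> (m <= 3 * k)%N ->
  exists F S : {set {set 'I_n}},
    [/\ F \in packings n #|F|, (#|F| <= k)%N, S \in extensions F #|S|,
        (m <= 3 * #|F| + 2 * #|S|)%N & sides_of (F :|: S) \subset edges G].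
Proof.
move=> mG mk.
pose P (F : {set {set 'I_n}}) :=
  [&& F \subset triangles G, trivIset F & (#|F| <= k)%N].
have [F /maxsetP[/and3P[FG Fd Fk] Fmax]] : {F | maxset P F}.
  apply: ex_maxset; exists set0; rewrite /P sub0set cards0 andbT.
  by apply/trivIsetP => A B; rewrite inE.
have tri3 : triangles G \subset triples n.
  by apply/subsetP=> t; rewrite inE => /andP[].
have FD : F \in packings n #|F|.
  by rewrite inE eqxx Fd (subset_trans FG).
exists F; have [Fk'|Fk'] := eqVneq #|F| k.
  exists set0; split => //; last by rewrite setU0 sides_of_triangles.
    by rewrite inE eqxx sub0set; apply/and3P; split=> //; apply/private_coverP=> t; rewrite inE.
  by rewrite Fk' (leq_trans mk) ?leq_addr.
(* By maximality, as [F] has fewer than k elements. *)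
have Fmeet t : t \in triangles G -> (#|t :\: cover F| <= 2)%N.
  move=> tG; have t3 : #|t| = 3%N by have := subsetP tri3 _ tG; rewrite inE => /eqP.
  rewrite -ltnS -t3; apply: proper_card; rewrite properEneq subsetDl andbT.
  apply/negP=> /eqP/setDidPl tF.
  have disj B : B \in F -> [disjoint t & B].
    by move=> BF; apply: disjointWr tF; apply: bigcup_sup BF.
  have F0 : set0 \notin F.
    by apply/negP=> /(subsetP FG)/(subsetP tri3); rewrite inE cards0.
  have [td tF'] := trivIsetU1 disj Fd F0.
  have := Fmax (t |: F); rewrite /P subUset sub1set tG FG td cardsU1 tF' add1n.
  rewrite ltn_neqAle Fk' Fk subsetUr => /(_ isT isT) tFF.
  by move: tF'; rewrite -tFF setU11.
pose Q (S : {set {set 'I_n}}) :=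
  (S \subset triangles G) && (m <= #|cover (F :|: S)|)%N.
have [S /minsetP[/andP[SG Sm] Smin]] : {S | minset Q S}.
  apply: ex_minset; exists (triangles G); rewrite /Q subxx (leq_trans mG)//.
  by apply: subset_leq_card; apply: coverS; apply: subsetUr.
exists S; split => //; last first.
- by rewrite sides_of_triangles // subUset FG.
- apply: (leq_trans Sm).
  have sub : cover (F :|: S) \subset cover F :|: \bigcup_(t in S) (t :\: cover F).
    apply/bigcupsP=> t; rewrite inE => /orP[tF|tS].
      by apply: subsetU; rewrite (bigcup_sup t).
    apply/subsetP=> x xt; rewrite inE; case: (boolP (x \in cover F)) => //= xF.
    by apply/bigcupP; exists t => //; rewrite inE xF.
  apply: leq_trans (subset_leq_card sub) _.
  apply: leq_trans (leq_card_setU _ _) _.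
  rewrite card_cover_packing ?(subset_trans FG) // leq_add2l mulnC -sum_nat_const.
  elim/big_rec2: _ => [|t s1 s2 tS IH]; first by rewrite cards0.
  apply: leq_trans (leq_card_setU _ _) _.
  by rewrite leq_add // Fmeet // (subsetP SG).
(* A triple without a private vertex could be removed from [S]. *)
- rewrite inE eqxx (subset_trans SG) // andbT.
  apply/private_coverP=> t tS; apply/negP=> tsub.
  have := Smin (S :\ t); rewrite /Q (subset_trans (subsetDl _ _) SG) subsetDl.
  suff -> : cover (F :|: S :\ t) = cover (F :|: S).
    by move=> /(_ Sm isT) St; move: tS; rewrite -St setD11.
  apply/eqP; rewrite eqEsubset coverS ?setUS ?subsetDl //=.
  apply/bigcupsP=> u; rewrite inE => uFS; have [->//|ut] := eqVneq u t.
  by apply: bigcup_sup; rewrite !inE ut.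
Qed.

(** Double counting of the pairs of a packing of size j and a triple disjoint from it; such
a pair determines a packing of size j + 1 with a distinguished element. *)
Lemma packings_step (R : numDomainType) n j :
  #|packings n j|%:R * 'C(n - 3 * j, 3)%:R <= #|packings n j.+1|%:R * j.+1%:R :> R.
Proof.
have -> : #|packings n j.+1|%:R * j.+1%:R = \sum_(F in packings n j.+1) 1 *+ #|F| :> R.
  rewrite (eq_bigr (fun=> j.+1%:R)).
    by rewrite mulr_natl sumr_const.
  by move=> F /packingsP[_ _ -> _ _].
rewrite (sum_remove_elt (mem (packings n j.+1)) (fun=> 1)).
rewrite mulr_natl -sumr_const big_mkcond; apply: ler_sum => F _.
case: ifPn => [FD|_]; last by rewrite sumr_ge0.
have [F3 Fd Fj _ _] := packingsP FD.
have -> : (n - 3 * j)%N = #|~: cover F|.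
  by rewrite -Fj -card_cover_packing // [RHS]cardsCs setCK card_ord.
rewrite -cards_draws -sumr_const; apply: ler_sum_sub => // t.
rewrite inE => /andP[tF t3].
have disj : [disjoint t & cover F] by rewrite disjoints_subset.
have tU B : B \in F -> [disjoint t & B].
  by move=> BF; apply: disjointWr disj; apply: bigcup_sup BF.
have F0 : set0 \notin F.
  by apply/negP=> /(subsetP F3); rewrite inE cards0.
have [td tF'] := trivIsetU1 tU Fd F0.
split=> //; rewrite tF' /=.
change (is_true (t |: F \in packings n j.+1)).
rewrite /packings in_set subUset sub1set F3 td cardsU1 tF' Fj.
by rewrite inE t3 eqxx.
Qed.

(** [L] bounds the ratio of the expected numbers of packings of two consecutive sizes, by
[packings_step]. *)
Lemma packings_ratio (R : realFieldType) n (p L : R) j k :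
  0 <= p -> (j <= k)%N ->
  (forall i, (j <= i < k)%N -> i.+1%:R <= L * p ^+ 3 * 'C(n - 3 * i, 3)%:R) ->
  0 <= L ->
  #|packings n j|%:R * p ^+ (3 * j) <= L ^+ (k - j) * (#|packings n k|%:R * p ^+ (3 * k)).
Proof.
move=> p0 jk hL L0; move: hL; rewrite -(subnKC jk) addKn; elim: (k - j)%N => [|d IH] hL.
  by rewrite addn0 expr0 mul1r.
rewrite addnS.
apply: le_trans (IH _) _.
  by move=> i /andP[ji ijd]; apply: hL; rewrite ji addnS ltnS ltnW.
rewrite exprSr -mulrA ler_wpM2l ?exprn_ge0 //.
have := packings_step R n (j + d); set q := #|_|; set q' := #|_|; set C := 'C(_, _) => st.
have hC := hL (j + d)%N; rewrite -/C leq_addr addnS leqnn in hC; have {}hC := hC isT.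
have C0 : 0 < C%:R :> R.
  rewrite lt_neqAle ler0n andbT; apply: contraTneq hC => <-.
  by rewrite mulr0 -ltNge ltr0n.
have -> : (3 * (j + d).+1 = 3 * (j + d) + 3)%N by lia.
rewrite exprD; set P := p ^+ (3 * _).
have -> : L * (q'%:R * (P * p ^+ 3)) = L * p ^+ 3 * q'%:R * P by ring.
rewrite ler_wpM2r ?exprn_ge0 // -(ler_pM2r C0); apply: le_trans st _.
by rewrite mulrAC [leRHS]mulrC ler_wpM2l.
Qed.

Lemma leq_cube_bin3 q : (3 <= q -> q ^ 3 <= 36 * 'C(q, 3))%N.
Proof.
move=> q3; have -> : (36 * 'C(q, 3) = 6 * (q ^_ 3))%N by rewrite -bin_ffact !factS fact0; lia.
rewrite !ffactnSr ffactn0 subn0 mul1n !expnS expn0 muln1.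
by case: q q3 => [|[|[|q]]] // _; nia.
Qed.

(** By [sum_new_sides] the mean number of triangles outside the packing, given that the
packing is present, is at most half of M + 1; Markov's inequality then applies. *)
Lemma packing_few_triangles (R : realType) n (p : R) k M (F : {set {set 'I_n}}) :
  0 <= p <= 1 -> F \in packings n k ->
  2 * ((n%:R * p) ^+ 3 + 4 * (n%:R * p) ^+ 2) <= M.+1%:R ->
  p ^+ (3 * k) <= 2 *
  \sum_(G : graph n | (sides_of F \subset edges G) && (#|triangles G| <= k + M)%N) gnp_mass p G.
Proof.
move=> p01 FD CM; have /andP[p0 p1] := p01.
have [F3 Fd Fk kn Fs] := packingsP FD.
have := gnp_contains p (sides_ofS F); rewrite Fs.
rewrite (bigID (fun G : graph n => #|triangles G| <= k + M)%N) /=.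
set A := \sum_(G : graph n | _) _; set B := \sum_(G : graph n | _) _.
suff : B * 2 <= p ^+ (3 * k) by move=> h e; rewrite -e in h *; lra.
rewrite -(ler_pM2r (ltr0Sn R M)).
set C : R := _ + _ in CM.
apply: (@le_trans _ _ (2 * (p ^+ (3 * k) * C))); last first.
  by rewrite mulrCA ler_wpM2l ?exprn_ge0.
rewrite mulrAC [leLHS]mulrC ler_wpM2l //.
pose T := triples n :\: F.
have Tnew t : t \in T -> (2 <= #|sides t :\: sides_of F|)%N.
  by rewrite inE => /andP[tF t3]; apply: packing_new_sides.
apply: (@le_trans _ _ (\sum_(t in T) \sum_(G : graph n | sides_of (t |: F) \subset edges G) gnp_mass p G)).
  rewrite (exchange_big_dep xpredT) //= mulr_suml; apply: ler_sum_sub => G; last first.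
    by rewrite sumr_ge0 // => t _; rewrite gnp_mass_ge0.
  move=> /andP[FG]; rewrite -ltnNge => trG; split=> //.
  rewrite sumr_const -[leRHS]mulr_natr ler_wpM2l ?gnp_mass_ge0 // ler_nat.
  apply: (@leq_trans #|triangles G :\: F|).
    rewrite cardsD ltn_subRL; apply: leq_ltn_trans trG.
    by rewrite leq_add2r -Fk subset_leq_card ?subsetIr.
  apply: subset_leq_card; apply/subsetP=> t; rewrite !inE => /and3P[tF t3 tG].
  by rewrite unfold_in /= !inE tF t3 sides_of1U subUset tG FG.
apply: (@le_trans _ _ (\sum_(t in T) p ^+ (3 * k) * p ^+ #|sides t :\: sides_of F|)).
  by apply: ler_sum => t tT; rewrite gnp_contains ?sides_ofS // -Fs -exprD card_sides_of1U.
rewrite -mulr_sumr ler_wpM2l ?exprn_ge0 //.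
apply: le_trans (sum_new_sides p01 (subsetDl _ _) Tnew) _.
have -> : C = n%:R ^+ 3 * p ^+ 3 + (4 * n)%:R * (n%:R * p ^+ 2).
  by rewrite /C natrM; ring.
by rewrite lerD2l ler_wpM2r ?mulr_ge0 ?exprn_ge0 // ler_nat Fs; lia.
Qed.

(** Summing [packing_few_triangles] over all packings counts each graph at most C(k + M, k)
times, since its packings of size k are sets of k among its at most k + M triangles.
This replaces a second moment computation. *)
Lemma triangle_vertices_lower (R : realType) n (p : R) m k M :
  0 <= p <= 1 -> (m <= 3 * k)%N ->
  2 * ((n%:R * p) ^+ 3 + 4 * (n%:R * p) ^+ 2) <= M.+1%:R ->
  #|packings n k|%:R * p ^+ (3 * k) <=
  2 * 'C(k + M, k)%:R * gnp_prob p (fun G : graph n => m <= num_triangle_vertices G)%N.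
Proof.
move=> p01 mk CM.
rewrite mulr_natl -sumr_const.
apply: (@le_trans _ _ (\sum_(F in packings n k) 2 * \sum_(G : graph n |
    (sides_of F \subset edges G) && (#|triangles G| <= k + M)%N) gnp_mass p G)).
  by apply: ler_sum => F FD; apply: packing_few_triangles.
rewrite -mulr_sumr -mulrA ler_wpM2l // (exchange_big_dep xpredT) //= mulr_sumr.
rewrite [leRHS]big_mkcond; apply: ler_sum => G _.
have mass0 := gnp_mass_ge0 G p01.
have cont (F : {set {set 'I_n}}) : F \in packings n k -> sides_of F \subset edges G -> F \subset triangles G.
  move=> /packingsP[F3 _ _ _ _] FG; apply/subsetP=> t tF.
  rewrite inE (subsetP F3 _ tF) /=; apply: subset_trans FG; exact: bigcup_sup tF.
case: ifPn => [mG|nmG]; last first.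
  rewrite big_pred0 // => F; apply/negbTE; apply: contra nmG => /and3P[FD FG _].
  have [F3 Fd Fk _ _] := packingsP FD.
  rewrite num_triangle_verticesE (leq_trans mk) // -Fk -card_cover_packing //.
  by apply: subset_leq_card; apply: coverS; apply: cont.
rewrite sumr_const -[leLHS]mulr_natl ler_wpM2r // ler_nat.
have [trG|trG] := leqP #|triangles G| (k + M); last first.
  by rewrite eq_card0 // => F; rewrite unfold_in /= !andbF.
apply: leq_trans (leq_bin2l k trG); rewrite -cards_draws.
apply: subset_leq_card; apply/subsetP=> F; rewrite unfold_in inE => /and3P[FD FG _].
by rewrite cont //=; have [_ _ -> _ _] := packingsP FD.
Qed.

(** * Deviations of the number of edges *)

(** Markov's inequality for exp (s e(G)); both tails are covered, according to the sign of [s]. *)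
Lemma gnp_chernoff (R : realType) n (p s b : R) (H : {set {set 'I_n}}) :
  0 <= p <= 1 -> H \subset vertex_pairs n ->
  \sum_(G : graph n | (H \subset edges G) && (b <= s * (num_edges G)%:R)) gnp_mass p G <=
  p ^+ #|H| * (expR (s * #|H|%:R - b) * (1 - p + p * expR s) ^+ #|vertex_pairs n :\: H|).
Proof.
move=> p01 Hn.
have -> : expR (s * #|H|%:R - b) = expR s ^+ #|H| * expR (- b).
  by rewrite expRD mulrC [s * _]mulrC expRM_natl mulrC.
have -> : p ^+ #|H| * (expR s ^+ #|H| * expR (- b) * (1 - p + p * expR s) ^+ #|vertex_pairs n :\: H|)
  = expR (- b) * ((p * expR s) ^+ #|H| * (1 - p + p * expR s) ^+ #|vertex_pairs n :\: H|).
  have alg (A B D E : R) : A * (B * E * D) = E * (A * B * D) by ring.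
  by rewrite exprMn alg.
rewrite -gnp_tilt // mulr_sumr; apply: ler_sum_sub => G.
  move=> /andP[HG bG]; split=> //; rewrite mulrCA ler_peMr ?gnp_mass_ge0 //.
  by rewrite -expRM_natl -expRD -[leLHS]expR0 ler_expR; lra.
by rewrite !mulr_ge0 ?gnp_mass_ge0 ?exprn_ge0 ?expR_ge0.
Qed.

(** From exp (- s) >= 1 - s by inversion, for either sign of [s]. *)
Lemma expR_le_quadratic (R : realType) (s : R) : s <= 1 / 2 -> expR s <= 1 + s + 2 * s ^+ 2.
Proof.
move=> s2; have h := expR_ge1Dx (- s).
have e0 := expR_gt0 s; rewrite expRN in h.
have : expR s * (1 - s) <= 1 by rewrite -ler_pdivlMl // mulr1.
have s0 : 0 < 1 - s by lra.
rewrite -ler_pdivlMr // div1r => /le_trans; apply.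
rewrite -[leLHS]mulr1 -ler_pdivlMl ?invr_gt0 // invrK.
nra.
Qed.

Lemma sum_exp_le_expR (R : realType) (x : R) N : 0 <= x ->
  \sum_(r < N) x ^+ r / r`!%:R <= expR x.
Proof.
move=> x0; rewrite -(big_mkord xpredT (fun r => x ^+ r / r`!%:R)).
apply: (nondecreasing_cvgn_le _ (is_cvg_series_exp_coeff x) N).
apply/nondecreasing_seqP => i; rewrite /series /= big_nat_recr //= lerDl.
by rewrite /exp_coeff divr_ge0 ?exprn_ge0 // ler0n.
Qed.

(** The number of pairs outside [H] times p is lambda n / 2 up to 5 lambda: lambda / 2 is
lost because there are n (n - 1) / 2 pairs, and 4 lambda because of [H]. *)
Lemma gnp_sparse_chernoff (R : realType) n (lambda s b : R) (H : {set {set 'I_n}}) :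
  0 < lambda -> (0 < n)%N -> lambda <= n%:R -> `|s| <= 1 / 2 ->
  H \subset vertex_pairs n -> (#|H| <= 4 * n)%N ->
  \sum_(G : graph n | (H \subset edges G) && (b <= s * (num_edges G)%:R))
     gnp_mass (lambda / n%:R) G <=
  (lambda / n%:R) ^+ #|H| *
  expR (s * #|H|%:R - b + lambda / 2 * n%:R * (s + 2 * s ^+ 2) + 5 * lambda).
Proof.
move=> l0 n0 ln s2 Hn H4.
have n0' : 0 < n%:R :> R by rewrite ltr0n.
have p0 : 0 <= lambda / n%:R by rewrite divr_ge0 ?ltW.
have p01 : 0 <= lambda / n%:R <= 1 by rewrite p0 ler_pdivrMr ?mul1r.
apply: le_trans (gnp_chernoff s b p01 Hn) _.
rewrite ler_wpM2l ?exprn_ge0 // -[_ - b + _ + _]addrA [expR (_ + (_ + _))]expRD ler_wpM2l ?expR_ge0 //.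
set p := lambda / n%:R in p0 p01 *; set N := #|_|.
have np : n%:R * p = lambda by rewrite /p mulrC divfK // gt_eqF.
have base : 1 - p + p * expR s <= expR (p * (s + 2 * s ^+ 2)).
  apply: le_trans (expR_ge1Dx _).
  have : p * expR s <= p * (1 + s + 2 * s ^+ 2).
    by apply/ler_wpM2l/expR_le_quadratic => //; move: s2; rewrite ler_norml => /andP[].
  by lra.
have base0 : 0 <= 1 - p + p * expR s.
  by case/andP: p01 => _ p1; rewrite addr_ge0 ?subr_ge0 // mulr_ge0 ?expR_ge0.
apply: le_trans (lerXn2r _ _ _ base) _; rewrite ?nnegrE ?expR_ge0 //.
rewrite -expRM_natl ler_expR.
have [Nlo Nhi] : lambda / 2 * n%:R - 5 * lambda <= N%:R * p /\ N%:R * p <= lambda / 2 * n%:R.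
  have card2 : (#|vertex_pairs n| * 2 = n * n.-1)%N.
    by rewrite card_draws card_ord mulnC -mul_bin_diag bin1.
  have Nle : (N * 2 <= n * n)%N.
    apply: (@leq_trans (n * n.-1)); last by rewrite leq_mul2l leq_pred orbT.
    by rewrite -card2 leq_mul2r subset_leq_card ?subsetDl.
  have Nge : (n * n <= N * 2 + 9 * n)%N.
    have nn : (n * n.-1 + n = n * n)%N by rewrite addnC -mulnS prednK.
    have cardV := cardsID H (vertex_pairs n); rewrite -/N in cardV.
    have cardI := subset_leq_card (subsetIr (vertex_pairs n) H).
    by rewrite -nn -card2 -cardV; lia.
  move: Nle Nge; rewrite -!(ler_nat R) !natrD !natrM => Nle Nge.
  split; rewrite -(ler_pM2l n0'); nra.
have q1 : -1 <= s + 2 * s ^+ 2 <= 1.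
  by move: s2; rewrite ler_norml => /andP[] ? ?; apply/andP; split; nra.
case/andP: q1; set q := s + _ => q1 q2; rewrite mulrA.
have [q0|q0] := lerP 0 q; nra.
Qed.

(** The term lambda / 2 n s of [gnp_sparse_chernoff] cancels the mean of the edges outside
[H], and s (#|H| - a n) is at most theta (3 + 3 r).  For small theta the gain
theta eps n wins over the quadratic term lambda theta ^ 2 n. *)
Lemma gnp_edges_deviation (R : realType) n (lambda a eps theta : R) (r : nat) (H : {set {set 'I_n}}) :
  0 < lambda -> (0 < n)%N -> lambda <= n%:R -> 0 <= theta <= 1 / 2 ->
  H \subset vertex_pairs n -> (#|H| <= 4 * n)%N ->
  a * n%:R - 2 * r%:R <= #|H|%:R <= a * n%:R + 3 + 3 * r%:R ->
  \sum_(G : graph n | (H \subset edges G) &&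
      (eps < `|(num_edges G)%:R / n%:R - (a + lambda / 2)|)) gnp_mass (lambda / n%:R) G <=
  (lambda / n%:R) ^+ #|H| *
  (2 * expR (5 * lambda + theta * (3 + 3 * r%:R) + lambda * theta ^+ 2 * n%:R - theta * eps * n%:R)).
Proof.
move=> l0 n0 ln /andP[t0 t1] Hn H4 /andP[Hlo Hhi].
have n0' : 0 < n%:R :> R by rewrite ltr0n.
have p0 : 0 <= lambda / n%:R by rewrite divr_ge0 ?ltW.
have p01 : 0 <= lambda / n%:R <= 1 by rewrite p0 ler_pdivrMr ?mul1r.
set E := expR _.
pose b s : R := s * (a + lambda / 2) * n%:R + theta * eps * n%:R.
(* The upper tail for s = theta, the lower one for s = - theta. *)
pose tail s := \sum_(G : graph n | (H \subset edges G) && (b s <= s * (num_edges G)%:R)) gnp_mass (lambda / n%:R) G.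
have tailE s : `|s| = theta -> tail s <= (lambda / n%:R) ^+ #|H| * E.
  move=> st; have s2 : `|s| <= 1 / 2 by rewrite st.
  apply: le_trans (gnp_sparse_chernoff (b s) l0 n0 ln s2 Hn H4) _.
  rewrite ler_wpM2l ?exprn_ge0 // ler_expR /b.
  have -> : theta ^+ 2 = s ^+ 2 by rewrite -st -normrX ger0_norm // sqr_ge0.
  have : s * (#|H|%:R - a * n%:R) <= theta * (3 + 3 * r%:R).
    have r0 : (0 : R) <= r%:R by [].
    move: st; case: (ger0P s) => s0 <-; first by apply: ler_wpM2l => //; lra.
    by rewrite -mulrNN; apply: ler_wpM2l; lra.
  nra.
apply: (@le_trans _ _ (tail theta + tail (- theta))); last first.
  rewrite mulrCA mulr_natl mulr2n; apply: lerD; apply: tailE; rewrite ?normrN ger0_norm //.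
rewrite [tail theta]big_mkcond [tail (- theta)]big_mkcond -big_split /= big_mkcond.
apply: ler_sum => G _; have m0 := gnp_mass_ge0 G p01.
case HG: (H \subset edges G) => /=; last by rewrite addr0.
set e := (num_edges G)%:R.
case: ifPn => [dev|_]; last by rewrite addr_ge0 //; case: ifP.
have [x0|x0] := lerP 0 (e / n%:R - (a + lambda / 2)).
  move: dev; rewrite ger0_norm // ltrBrDr ltr_pdivlMr // => dev.
  have -> : b theta <= theta * e by rewrite /b; nra.
  by rewrite lerDl; case: ifP.
move: dev; rewrite ltr0_norm // opprB ltrBrDr -ltrBrDl ltr_pdivrMr // => dev.
have -> : b (- theta) <= - theta * e by rewrite /b; nra.
by rewrite lerDr; case: ifP.
Qed.

(** * Comparison of the joint and the conditioning events *)

Lemma gnp_union_bound (R : realType) n (p : R) (A : pred (graph n)) (I : finType)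
    (W : pred I) (Q : I -> pred (graph n)) :
  0 <= p <= 1 -> (forall G, A G -> exists2 w, W w & Q w G) ->
  gnp_prob p A <= \sum_(w | W w) \sum_(G | Q w G && A G) gnp_mass p G.
Proof.
move=> p01 AQ; rewrite (exchange_big_dep xpredT) //=.
rewrite /gnp_prob big_mkcond; apply: ler_sum => G _.
have m0 := gnp_mass_ge0 G p01; case: ifPn => [AG|_]; last by rewrite sumr_ge0.
have [w Ww QG] := AQ G AG.
by rewrite (bigD1 w) ?Ww ?QG //= lerDl sumr_ge0.
Qed.

Lemma gnp_witness_bound (R : realType) n (p : R) (A : pred (graph n)) m k :
  0 <= p <= 1 -> (m <= 3 * k)%N ->
  gnp_prob p (predI A (fun G : graph n => m <= num_triangle_vertices G)%N) <=
  \sum_(j < k.+1) \sum_(r < n.+1 | (m <= 3 * j + 2 * r)%N)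
    \sum_(F in packings n j) \sum_(S in extensions F r)
      \sum_(G : graph n | (sides_of (F :|: S) \subset edges G) && A G) gnp_mass p G.
Proof.
move=> p01 mk.
rewrite pair_big_dep /=.
under eq_bigr => w _ do rewrite pair_big_dep /=.
rewrite pair_big_dep /=.
apply: (@le_trans _ _ _ _ _ (@gnp_union_bound R n p _
  (('I_k.+1 * 'I_n.+1) * ({set {set 'I_n}} * {set {set 'I_n}}))%type
  (fun w => (m <= 3 * w.1.1 + 2 * w.1.2)%N &&
                 ((w.2.1 \in packings n w.1.1) && (w.2.2 \in extensions w.2.1 w.1.2)))
  (fun w G => sides_of (w.2.1 :|: w.2.2) \subset edges G) p01 _)).
  move=> G /andP[_]; rewrite num_triangle_verticesE => mG.
  have [F [S [FD Fk SE mFS FSG]]] := triangle_witness mG mk.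
  have Sn : (#|S| < n.+1)%N.
    by rewrite ltnS; apply: (@card_private_cover _ F); move: SE; rewrite inE => /and3P[].
  have Fk' : (#|F| < k.+1)%N by [].
  by exists ((Ordinal Fk', Ordinal Sn), (F, S)) => //=; rewrite mFS FD SE.
apply: ler_sum => w _; apply: ler_sum_sub => G; last by rewrite gnp_mass_ge0.
by move=> /andP[-> /andP[-> _]].
Qed.

(** The factor y ^ (2 r + 2) pays for passing from j to k triples, as 3 (k - j) <= 2 r + 2
and L <= y ^ 3.  Summing over r the terms (y ^ 2 C exp (3 theta)) ^ r / r! yields the
last exponential. *)
Lemma gnp_joint_upper (R : realType) n (lambda a eps theta y L : R) m k :
  0 < lambda -> (0 < n)%N -> lambda <= n%:R -> 0 <= theta <= 1 / 2 ->
  a * n%:R <= m%:R <= a * n%:R + 1 -> (m <= 3 * k)%N -> (3 * k <= m + 2)%N ->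
  1 <= y -> 0 <= L -> L <= y ^+ 3 ->
  (forall i, (i < k)%N -> i.+1%:R <= L * (lambda / n%:R) ^+ 3 * 'C(n - 3 * i, 3)%:R) ->
  gnp_prob (lambda / n%:R)
    (predI (fun G : graph n => eps < `|(num_edges G)%:R / n%:R - (a + lambda / 2)|)
           (fun G : graph n => m <= num_triangle_vertices G)%N) <=
  #|packings n k|%:R * (lambda / n%:R) ^+ (3 * k) * (k.+1%:R * (y ^+ 2 *
    (2 * expR (5 * lambda + 3 * theta + lambda * theta ^+ 2 * n%:R - theta * eps * n%:R
       + y ^+ 2 * ((lambda ^+ 3 + 4 * lambda ^+ 2) * expR (3 * theta)))))).
Proof.
move=> l0 n0 ln t01 /andP[am ma] mk km y1 L0 Ly hL.
have /andP[t0 _] := t01.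
have arith h j r : (3 * j <= h -> h <= 3 * j + 3 * r -> 3 * j <= n -> r <= n ->
    m <= 3 * j + 2 * r -> j <= k ->
    [/\ h <= 4 * n, m <= h + 2 * r & h <= m + 2 + 3 * r])%N.
  by move: km; clear => *; split; lia.
have n0' : 0 < n%:R :> R by rewrite ltr0n.
have p0 : 0 <= lambda / n%:R by rewrite divr_ge0 ?ltW.
have p01 : 0 <= lambda / n%:R <= 1 by rewrite p0 ler_pdivrMr ?mul1r.
have np : n%:R * (lambda / n%:R) = lambda by rewrite mulrC divfK // gt_eqF.
set p := lambda / n%:R in p0 p01 np hL *.
set X := _%:R * p ^+ _; have X0 : 0 <= X by rewrite mulr_ge0 ?exprn_ge0.
set C := _ ^+ 3 + _ * _.
have C0 : 0 <= C by rewrite addr_ge0 ?mulr_ge0 ?exprn_ge0 // ltW.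
set e0 := 5 * lambda + 3 * theta + lambda * theta ^+ 2 * n%:R - theta * eps * n%:R.
apply: le_trans (gnp_witness_bound _ p01 mk) _.
set z := y ^+ 2 * (C * _).
have z0 : 0 <= z by rewrite !mulr_ge0 ?exprn_ge0 ?expR_ge0 // (le_trans _ y1).
have y0 : 0 <= y by rewrite (le_trans _ y1).
(* Up to the factor X, the bound on each term does not depend on j. *)
suff main (j : 'I_k.+1) (r : 'I_n.+1) : (m <= 3 * j + 2 * r)%N ->
    \sum_(F in packings n j) \sum_(S in extensions F r)
      \sum_(G : graph n | (sides_of (F :|: S) \subset edges G) &&
         (eps < `|(num_edges G)%:R / n%:R - (a + lambda / 2)|)) gnp_mass p G
    <= X * (y ^+ 2 * (2 * expR e0)) * (z ^+ r / r`!%:R).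
  apply: (@le_trans _ _ (\sum_(j < k.+1) X * (y ^+ 2 * (2 * expR e0)) * expR z)).
    apply: ler_sum => j _.
    apply: (@le_trans _ _ (\sum_(r < n.+1) X * (y ^+ 2 * (2 * expR e0)) * (z ^+ r / r`!%:R))).
      apply: ler_sum_sub => [r mr|r _]; first by split => //; apply: main.
      by rewrite !mulr_ge0 ?exprn_ge0 ?expR_ge0 ?invr_ge0.
    rewrite -mulr_sumr ler_wpM2l ?sum_exp_le_expR //.
    by rewrite !mulr_ge0 ?exprn_ge0 ?expR_ge0.
  rewrite sumr_const card_ord -[leLHS]mulr_natr [expR (e0 + z)]expRD.
  by rewrite le_eqVlt; apply/orP; left; apply/eqP; ring.
move=> mjr; have jk : (j <= k)%N by rewrite -ltnS.
pose B : R := 2 * expR (e0 + 3 * theta * r%:R).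
have B0 : 0 <= B by rewrite mulr_ge0 ?expR_ge0.
have inner F S : F \in packings n j -> S \in extensions F r ->
    \sum_(G : graph n | (sides_of (F :|: S) \subset edges G) &&
         (eps < `|(num_edges G)%:R / n%:R - (a + lambda / 2)|)) gnp_mass p G
    <= p ^+ #|sides_of (F :|: S)| * B.
  move=> /packingsP[F3 Fd Fj jn Fs]; rewrite inE => /and3P[S3 Spc /eqP Sr].
  have rn : (r <= n)%N by rewrite -ltnS.
  have Hup : (#|sides_of (F :|: S)| <= 3 * j + 3 * r)%N.
    rewrite -Fj -Sr -mulnDr; apply: leq_trans (_ : _ <= 3 * #|F :|: S|)%N _.
      by apply: card_sides_of_le; rewrite subUset F3 S3.
    by rewrite leq_mul2l /=; apply: leq_card_setU.
  have Hlo : (3 * j <= #|sides_of (F :|: S)|)%N.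
    by rewrite -Fs subset_leq_card // sides_ofU subsetUl.
  have [Hn h1 h2] := arith _ _ _ Hlo Hup jn rn mjr jk.
  have Hr : a * n%:R - 2 * r%:R <= #|sides_of (F :|: S)|%:R <= a * n%:R + 3 + 3 * r%:R.
    move: h1; rewrite -(ler_nat R) natrD natrM => h1.
    move: h2; rewrite -(ler_nat R) 2!natrD natrM => h2.
    by apply/andP; split; lra.
  apply: le_trans (gnp_edges_deviation eps l0 n0 ln t01 (sides_ofS _) Hn Hr) _.
  rewrite ler_wpM2l ?exprn_ge0 // /B ler_wpM2l // ler_expR /e0.
  lra.
apply: (@le_trans _ _ (\sum_(F in packings n j) (p ^+ (3 * j) * C ^+ r / r`!%:R) * B)).
  apply: ler_sum => F FD.
  have := sum_extensions r p01 FD; rewrite np -/C => /(ler_wpM2r B0); apply: le_trans.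
  by rewrite mulr_suml; apply: ler_sum => S SE; apply: inner.
rewrite sumr_const -[leLHS]mulr_natl.
have XB : #|packings n j|%:R * p ^+ (3 * j) <= y ^+ (2 * r + 2) * X.
  apply: le_trans (packings_ratio p0 jk _ L0) _.
    by move=> i /andP[_]; apply: hL.
  rewrite -/X ler_wpM2r //; apply: (@le_trans _ _ (y ^+ (3 * (k - j)))).
    by rewrite exprM lerXn2r // ?nnegrE ?exprn_ge0.
  by apply: ler_weXn2l => //; clear -km mjr jk; lia.
have -> : X * (y ^+ 2 * (2 * expR e0)) * (z ^+ r / r`!%:R) =
          y ^+ (2 * r + 2) * X * (C ^+ r / r`!%:R * B).
  have -> : B = 2 * expR e0 * expR (3 * theta) ^+ r.
    by rewrite /B -expRM_natl expRD [r%:R * _]mulrC mulrA.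
  have -> : y ^+ (2 * r + 2) = (y ^+ 2) ^+ r * y ^+ 2 by rewrite exprD exprM.
  by rewrite /z !exprMn; ring.
have -> : #|packings n j|%:R * (p ^+ (3 * j) * C ^+ r / r`!%:R * B) =
   #|packings n j|%:R * p ^+ (3 * j) * (C ^+ r / r`!%:R * B) by ring.
by rewrite ler_wpM2r // mulr_ge0 // mulr_ge0 ?exprn_ge0 // invr_ge0 ler0n.
Qed.

(** The rounded-up value of [x], in the form of a Galois connection. *)
Lemma nat_threshold (R : realType) (x : R) : 0 <= x ->
  exists m : nat, x <= m%:R <= x + 1 /\ forall v : nat, (x <= v%:R) = (m <= v)%N.
Proof.
move=> x0; have ex : exists v : nat, x <= v%:R.
  by exists (Num.truncn x).+1; rewrite ltW // truncnS_gt.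
case: (ex_minnP ex) => m xm mmin; exists m; split.
  rewrite xm; case: m mmin {xm} => [|m] mmin; first by rewrite addr_ge0.
  rewrite -natr1 lerD2r leNgt; apply/negP=> /ltW /mmin; by rewrite ltnn.
move=> v; apply/idP/idP => [/mmin //|mv]; apply: le_trans xm _; by rewrite ler_nat.
Qed.

(** The choice y ^ 2 = eta n makes the sum over r contribute a factor exponential in n, but
with an arbitrarily small rate eta, while y ^ 3 still exceeds the cost O(n) of one
triple for large n. *)
Lemma gnp_cond_prob_bound (R : realType) n (lambda a eps theta eta : R) M :
  0 < lambda -> (0 < n)%N -> lambda <= n%:R -> 0 <= theta <= 1 / 2 ->
  0 < a < 1 -> 3 <= (1 - a) * n%:R ->
  2 * (lambda ^+ 3 + 4 * lambda ^+ 2) <= M.+1%:R ->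
  0 < eta -> 1 <= eta * n%:R -> (36 / ((1 - a) * lambda) ^+ 3 / eta) ^+ 2 <= eta * n%:R ->
  gnp_cond_prob (lambda / n%:R)
       (fun G : graph n => eps < `|(num_edges G)%:R / n%:R - (a + lambda / 2)|)
       (fun G : graph n => a * n%:R <= (num_triangle_vertices G)%:R) <=
  2 * (n + M.+1)%:R ^+ M * (n.+2%:R * (eta * n%:R *
    (2 * expR (5 * lambda + 3 * theta + lambda * theta ^+ 2 * n%:R - theta * eps * n%:R
       + eta * n%:R * ((lambda ^+ 3 + 4 * lambda ^+ 2) * expR (3 * theta)))))).
Proof.
move=> l0 n0 ln t01 /andP[a0 a1] an3 CM eta0 eta1 etaL.
have n0' : 0 < n%:R :> R by rewrite ltr0n.
have p0 : 0 <= lambda / n%:R by rewrite divr_ge0 ?ltW.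
have p01 : 0 <= lambda / n%:R <= 1 by rewrite p0 ler_pdivrMr ?mul1r.
have np : n%:R * (lambda / n%:R) = lambda by rewrite mulrC divfK // gt_eqF.
have [m [mb mE]] : exists m : nat, a * n%:R <= m%:R <= a * n%:R + 1 /\
    forall v : nat, (a * n%:R <= v%:R) = (m <= v)%N.
  by apply: nat_threshold; rewrite mulr_ge0 ?ltW.
pose k := ((m + 2) %/ 3)%N.
have mk : (m <= 3 * k)%N by rewrite /k; clear; lia.
have km : (3 * k <= m + 2)%N by rewrite /k; clear; lia.
clearbody k.
have mn : (m <= n)%N by rewrite -mE ler_piMl // ltW.
have kn : (k <= n.+1)%N by clear -km mn; lia.
pose y := Num.sqrt (eta * n%:R).
have en0 : 0 <= eta * n%:R by rewrite mulr_ge0 ?ltW.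
have yy : y ^+ 2 = eta * n%:R by rewrite sqr_sqrtr.
have y1 : 1 <= y by rewrite -sqrtr1 ler_sqrt.
pose L0 := 36 / ((1 - a) * lambda) ^+ 3.
have al0 : 0 < (1 - a) * lambda by rewrite mulr_gt0 ?subr_gt0.
have L00 : 0 <= L0 by rewrite divr_ge0 ?exprn_ge0 // ltW.
have Ly : L0 * n%:R <= y ^+ 3.
  rewrite exprS yy mulrA ler_wpM2r // -ler_pdivrMr // -ler_sqr ?nnegrE ?yy //.
    by rewrite divr_ge0 // ltW.
  exact: le_trans y1.
(* As 3 i <= a n for i < k, at least (1 - a) n vertices are not covered by a packing of
   size i; this uses a < 1. *)
have hL i : (i < k)%N ->
   i.+1%:R <= L0 * n%:R * (lambda / n%:R) ^+ 3 * 'C(n - 3 * i, 3)%:R.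
  move=> ik; have i3 : (3 * i.+1 <= m + 2)%N by clear -ik km; lia.
  have q_ge : (1 - a) * n%:R <= (n - 3 * i)%:R.
    have i3n : (3 * i <= n)%N by clear -i3 mn; lia.
    rewrite natrB // natrM; move: i3; rewrite -(ler_nat R) natrM natrD -natr1.
    by move: mb => /andP[]; lra.
  have q3 : (3 <= n - 3 * i)%N by rewrite -(ler_nat R) (le_trans an3).
  have i_n : i.+1%:R <= n%:R :> R by rewrite ler_nat; clear -ik km mn n0; lia.
  apply: le_trans i_n _.
  have := leq_cube_bin3 q3; rewrite -(ler_nat R) natrX natrM; set c := 'C(_, _)%:R => hc.
  have {}hc : ((1 - a) * n%:R) ^+ 3 <= 36 * c.
    by apply: le_trans hc; rewrite lerXn2r ?nnegrE // (le_trans _ an3).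
  have -> : L0 * n%:R * (lambda / n%:R) ^+ 3 * c = n%:R * ((36 * c) / ((1 - a) * n%:R) ^+ 3).
    by rewrite /L0; field; rewrite !gt_eqF ?subr_gt0.
  by rewrite ler_peMr // ler_pdivlMr ?mul1r // exprn_gt0 // mulr_gt0 ?subr_gt0.
pose dev (G : graph n) := eps < `|(num_edges G)%:R / n%:R - (a + lambda / 2)|.
pose cov (G : graph n) := (m <= num_triangle_vertices G)%N.
have numE : gnp_prob (lambda / n%:R)
      (predI dev (fun G : graph n => a * n%:R <= (num_triangle_vertices G)%:R)) =
    gnp_prob (lambda / n%:R) (predI dev cov).
  by apply: eq_bigl => G; rewrite /= mE.
have denE : gnp_prob (lambda / n%:R)
      (fun G : graph n => a * n%:R <= (num_triangle_vertices G)%:R) =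
    gnp_prob (lambda / n%:R) cov.
  by apply: eq_bigl => G; rewrite mE.
rewrite /gnp_cond_prob numE denE {numE denE}.
have up := gnp_joint_upper eps l0 n0 ln t01 mb mk km y1 (mulr_ge0 L00 (ltW n0')) Ly hL.
have CM' : 2 * ((n%:R * (lambda / n%:R)) ^+ 3 + 4 * (n%:R * (lambda / n%:R)) ^+ 2) <= M.+1%:R by rewrite np.
have lo := triangle_vertices_lower p01 mk CM'.
rewrite yy -/dev -/cov in up; rewrite -/cov in lo.
set D := gnp_prob _ cov in lo *; set N := gnp_prob _ _ in up *.
set X := #|_|%:R * _ in up lo; set e := expR _ in up *.
have e_ge0 : 0 <= e by apply: expR_ge0.
have D0 : 0 <= D by rewrite sumr_ge0 // => G _; rewrite gnp_mass_ge0.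
have R0 : 0 <= 2 * (n + M.+1)%:R ^+ M * (n.+2%:R * (eta * n%:R * (2 * e))).
  by rewrite !mulr_ge0 ?exprn_ge0 // ltW.
(* If [D] is zero, the quotient is zero by convention. *)
have [D_gt0|] := ltrP 0 D; last by move=> Dle; rewrite (_ : D = 0) ?invr0 ?mulr0 //; apply/le_anti/andP.
rewrite ler_pdivrMr //.
apply: le_trans up _.
have B0 : 0 <= k.+1%:R * (eta * n%:R * (2 * e)) by rewrite !mulr_ge0 // ltW.
apply: le_trans (ler_wpM2r B0 lo) _.
have QM : 'C(k + M, k)%:R <= (n + M.+1)%:R ^+ M :> R.
  rewrite -natrX ler_nat -bin_sub ?leq_addr // addKn.
  by apply: leq_trans (bin_le_exp _ _) _; case: (M) => // M'; rewrite leq_exp2r //; clear -kn; lia.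
set Z := eta * n%:R * (2 * e) in B0 *; set W := (n + M.+1)%:R ^+ M in QM *.
have Z0 : 0 <= Z by rewrite !mulr_ge0 // ltW.
have -> : 2 * 'C(k + M, k)%:R * D * (k.+1%:R * Z) = ('C(k + M, k)%:R * (k.+1%:R * Z)) * (2 * D) by ring.
have -> : 2 * W * (n.+2%:R * Z) * D = (W * (n.+2%:R * Z)) * (2 * D) by ring.
rewrite ler_wpM2r ?mulr_ge0 // ler_pM // ler_wpM2r // ler_nat.
by clear -kn; lia.
Qed.

Local Open Scope classical_set_scope.
Local Open Scope ring_scope.

(** From x ^ (d + 1) / (d + 1)! <= exp x at x = t n. *)
Lemma monomial_expN_le (R : realType) (t : R) d n : 0 < t -> (0 < n)%N ->
  n%:R ^+ d * expR (- (t * n%:R)) <= (d.+1)`!%:R / t ^+ d.+1 / n%:R.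
Proof.
move=> t0 n0; have n0' : 0 < n%:R :> R by rewrite ltr0n.
have f0 : 0 < (d.+1)`!%:R :> R by rewrite ltr0n fact_gt0.
have h : (t * n%:R) ^+ d.+1 / (d.+1)`!%:R <= expR (t * n%:R).
  have tn0 : 0 <= t * n%:R by rewrite mulr_ge0 // ltW.
  apply: le_trans (expR_ge1Dxn d tn0).
  by rewrite lerDr.
rewrite expRN ler_pdivrMr ?expR_gt0 //.
have -> : n%:R ^+ d = (d.+1)`!%:R / t ^+ d.+1 / n%:R * ((t * n%:R) ^+ d.+1 / (d.+1)`!%:R).
  rewrite exprMn [n%:R ^+ d.+1]exprS; set T := t ^+ d.+1; set N := n%:R ^+ d; set f := _%:R in f0 *.
  by field; rewrite !gt_eqF // exprn_gt0.
by rewrite ler_wpM2l // !mulr_ge0 ?invr_ge0 ?exprn_ge0 // ltW.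
Qed.

Theorem theorem2p3 (R : realType) (lambda a : R)
    (hlambda : 0 < lambda) (ha0 : 0 < a) (ha1 : a < 1)
    (eps : R) (heps : 0 < eps) :
  (fun n : nat =>
     gnp_cond_prob (lambda / n%:R)
       (fun G : graph n =>
          eps < `|(num_edges G)%:R / n%:R - (a + lambda / 2)|)
       (fun G : graph n => a * n%:R <= (num_triangle_vertices G)%:R))
    @ \oo --> (0 : R).
Proof.
(* [theta] makes the quadratic loss at most half of the gain theta eps n, leaving a rate
   [c]; [eta] makes the sum over extensions consume at most half of that rate. *)
pose theta := Num.min (1 / 2) (eps / (2 * lambda)).
have t0 : 0 < theta by rewrite /theta lt_min !divr_gt0 ?mulr_gt0 //.
have t1 : theta <= 1 / 2 by rewrite /theta ge_min lexx.
have te : lambda * theta <= eps / 2.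
  rewrite mulrC -ler_pdivlMr // -mulrA -invfM /theta.
  by rewrite ge_min lexx orbT.
pose c := theta * eps / 2.
have c0 : 0 < c by rewrite divr_gt0 ?mulr_gt0.
pose C := lambda ^+ 3 + 4 * lambda ^+ 2.
pose E := C * expR (3 * theta).
have E0 : 0 < E by rewrite mulr_gt0 ?expR_gt0 // addr_gt0 ?mulr_gt0 ?exprn_gt0.
pose eta := c / 2 / E.
have eta0 : 0 < eta by apply: divr_gt0 => //; apply: divr_gt0.
have [M CM] : exists M : nat, 2 * C <= M.+1%:R.
  by exists (Num.truncn (2 * C)); rewrite ltW // truncnS_gt.
pose K0 := 5 * lambda + 3 * theta.
pose A := 2 * M.+2%:R ^+ M * (3 * (eta * (2 * expR K0))) *
  ((M + 2).+1`!%:R / (c / 2) ^+ (M + 2).+1) * 2.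
(* Thresholds on n for the three size conditions of [gnp_cond_prob_bound]. *)
pose b1 := 3 / (1 - a).
pose b2 := eta^-1.
pose b3 := (36 / ((1 - a) * lambda) ^+ 3 / eta) ^+ 2 / eta.
have a1 : 0 < 1 - a by rewrite subr_gt0.
have b10 : 0 <= b1 by rewrite divr_ge0 // ltW.
have b20 : 0 <= b2 by rewrite invr_ge0 ltW.
have b30 : 0 <= b3 by rewrite divr_ge0 ?sqr_ge0 // ltW.
pose N0 := (Num.truncn (lambda + b1 + b2 + b3)).+1.
(* The bound is of order 1 / n, compared with harmonic n = 1 / (n + 1): hence the last
   factor 2 in [A]. *)
apply: (@squeeze_cvgr _ _ _ _ (fun=> 0) (fun n : nat => A * harmonic n)); last 2 first.
- exact: cvg_cst.
- rewrite -[X in _ --> X](mulr0 A); apply: cvgM; [exact: cvg_cst|exact: cvg_harmonic].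
exists N0 => // n /= N0n.
have nN : lambda + b1 + b2 + b3 <= n%:R.
  by apply: le_trans (ltW (truncnS_gt _)) _; rewrite ler_nat.
have n0 : (0 < n)%N by apply: leq_trans N0n.
have n0' : 0 < n%:R :> R by rewrite ltr0n.
have ln : lambda <= n%:R by lra.
have p01 : 0 <= lambda / n%:R <= 1 by rewrite divr_ge0 ?ler_pdivrMr ?mul1r // ltW.
apply/andP; split.
  by rewrite divr_ge0 // sumr_ge0 // => G _; rewrite gnp_mass_ge0.
have h1 : 3 <= (1 - a) * n%:R by rewrite mulrC -ler_pdivrMr // -/b1; lra.
have h2 : 1 <= eta * n%:R by rewrite mulrC -ler_pdivrMr // div1r -/b2; lra.
have h3 : (36 / ((1 - a) * lambda) ^+ 3 / eta) ^+ 2 <= eta * n%:R.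
  by rewrite [eta * _]mulrC -ler_pdivrMr // -/b3; lra.
apply: le_trans (gnp_cond_prob_bound eps (theta := theta) hlambda n0 ln _ _ h1 CM eta0 h2 h3) _.
- by rewrite t1 ltW.
- by rewrite ha0.
rewrite -/C -/E -/K0.
have ex : expR (K0 + lambda * theta ^+ 2 * n%:R - theta * eps * n%:R + eta * n%:R * E)
    <= expR K0 * expR (- (c / 2 * n%:R)).
  rewrite -expRD ler_expR.
  have -> : eta * n%:R * E = c / 2 * n%:R by rewrite mulrAC /eta divfK // gt_eqF.
  have : lambda * theta ^+ 2 * n%:R <= c * n%:R.
    by rewrite ler_wpM2r // expr2 mulrA mulrC /c -mulrA ler_wpM2l // ltW.
  have -> : theta * eps * n%:R = 2 * (c * n%:R) by rewrite /c; field.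
  by have : 0 <= c * n%:R by [rewrite mulr_ge0 // ltW]; lra.
have W1 : (n + M.+1)%:R ^+ M <= M.+2%:R ^+ M * n%:R ^+ M :> R.
  by rewrite -exprMn lerXn2r ?nnegrE ?mulr_ge0 // -natrM ler_nat; clear -n0; nia.
have W2 : n.+2%:R <= 3 * n%:R :> R by rewrite -natrM ler_nat; clear -n0; lia.
have dec := monomial_expN_le (M + 2) (divr_gt0 c0 (ltr0Sn R 1)) n0.
set D := expR (- _) in ex dec *; set X := expR _ in ex *.
have D0 : 0 <= D by apply: expR_ge0.
have X0 : 0 <= X by apply: expR_ge0.
have eK0 : 0 <= expR K0 by apply: expR_ge0.
have e0 := ltW eta0; clearbody eta.
apply: (@le_trans _ _ (2 * (M.+2%:R ^+ M * n%:R ^+ M) *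
   (3 * n%:R * (eta * n%:R * (2 * (expR K0 * D)))))).
  apply: ler_pM; [by rewrite mulr_ge0 ?exprn_ge0 | by rewrite !mulr_ge0 | exact: ler_wpM2l |].
  by apply: ler_pM; rewrite ?mulr_ge0 // ler_wpM2l ?mulr_ge0 // ler_wpM2l.
have -> : 2 * (M.+2%:R ^+ M * n%:R ^+ M) * (3 * n%:R * (eta * n%:R * (2 * (expR K0 * D))))
  = 2 * M.+2%:R ^+ M * (3 * (eta * (2 * expR K0))) * (n%:R ^+ (M + 2) * D).
  have -> : n%:R ^+ (M + 2) = n%:R ^+ M * n%:R ^+ 2 :> R by rewrite exprD.
  move: (n%:R ^+ M) (_ ^+ M) (expR K0) => u v w; ring.
set P := 2 * M.+2%:R ^+ M * _; have P0 : 0 <= P by rewrite !mulr_ge0 ?exprn_ge0.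
rewrite /A -/P -2!mulrA ler_wpM2l //; apply: le_trans dec _.
rewrite ler_wpM2l //; first by rewrite divr_ge0 // exprn_ge0 // divr_ge0 // ltW.
rewrite /harmonic /= -invf_div lef_pV2 ?posrE ?divr_gt0 //.
rewrite ler_pdivrMr // -natrM ler_nat; clear -n0; lia.
Qed.
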